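(* Let $X$ be a graph on at least three vertices with Laplacian matrix $L$, and let $a,b$ be distinct vertices. Let \[g=\gcd\{\mu_r-\mu_s:\ \mu_r,\mu_s\in\Phi_{ab}^+\ \text{or}\ \mu_r,\mu_s\in\Phi_{ab}^-\}.\] Then proper Laplacian fractional revival occurs between $a$ and $b$ if and only if all of the following hold: (i) $a$ and $b$ are Laplacian strongly cospectral; (ii) $\Phi_{ab}^+\cup\Phi_{ab}^-\subseteq\mathbb{Z}_{\ge 0}$; (iii) some element of $\Phi_{ab}^-$ is not divisible by $g$. Moreover, if proper Laplacian fractional revival occurs between $a$ and $b$ at time $\tau$, then $\tau$ is an integer multiple of $2\pi/g$.
   Context: For a graph $X$ with adjacency matrix $A$ and diagonal degree matrix $D$, the Laplacian is $L=D-A$, with spectral decomposition $L=\sum_r\mu_rF_r$, where the $\mu_r$ are the distinct eigenvalues and $F_r$ is the orthogonal projection onto the $\mu_r$-eigenspace. The transition matrix is $U(t)=\exp(itL)=\sum_r e^{it\mu_r}F_r$. $X$ admits Laplacian fractional revival (LaFR) from $a$ to $b$ at time $\tau$ if $U(\tau)e_a=\alpha e_a+\beta e_b$ for some complex $\alpha,\beta$; it is proper if $\beta\neq 0$. Vertices $a,b$ are Laplacian strongly cospectral if $F_re_a=\pm F_re_b$ for every $r$. Define $\Phi_{ab}^+=\{\mu_r: F_re_a=F_re_b\neq 0\}$, $\Phi_{ab}^-=\{\mu_r: F_re_a=-F_re_b\neq 0\}$, $\Phi_{ab}^0=\{\mu_r:F_re_a=F_re_b=0\}$.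
   Formalization: The final clause (τ is an integer multiple of 2π/g) is stated for g ≠ 0, with g ≠ 0 proved for connected X when proper revival occurs; for a K₂ component of a disconnected graph (e.g. K₂ ∪ K₁) g = 0 and 2π/g is undefined. *)

(* Defs.v *)
From mathcomp Require Import all_boot all_order all_algebra.
From mathcomp Require Import all_classical all_reals all_analysis.
From mathcomp Require Import complex.

Set Implicit Arguments.
Unset Strict Implicit.
Unset Printing Implicit Defensive.

Import Order.TTheory GRing.Theory Num.Theory.

Local Open Scope classical_set_scope.
Local Open Scope ring_scope.
Local Open Scope complex_scope.

(* A finite simple graph on the vertex set 'I_n is given by its adjacency
   relation, a symmetric and irreflexive [adj : rel 'I_n]. *)

Section Laplacian.
Variables (K : nzRingType) (n : nat) (adj : rel 'I_n).

Definition adjacency_mx : 'M[K]_n := \matrix_(i, j) (adj i j)%:R.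

Definition degree_mx : 'M[K]_n := diag_mx (\row_i #|[set j | adj i j]%SET|%:R).

Definition laplacian : 'M[K]_n := degree_mx - adjacency_mx.

End Laplacian.

Section Revival.
Variables (R : realType) (n : nat) (adj : rel 'I_n).

(* Vectors are row vectors, on which matrices act from the right, as in
   [eigenspace] and [proj_ortho]: the column vector F e_a is rendered as [basis_vec a *m F].
   L, its eigenprojections and U(t) are symmetric, so nothing depends on this. *)
Definition basis_vec (a : 'I_n) : 'rV[R[i]]_n := delta_mx 0 a.

(* The Laplacian is Hermitian, so its eigenvalues are real. *)
Definition lap_spectrum : set R :=
  [set mu | eigenvalue (laplacian R[i] adj) mu%:C].

Definition lap_proj (mu : R) : 'M[R[i]]_n :=
  proj_ortho (eigenspace (laplacian R[i] adj) mu%:C).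

(* exp(i x) *)
Definition expi (x : R) : R[i] := cos x +i* sin x.

(* U(t) = exp(i t L), through the spectral decomposition of L; the sum is over
   the finite set of distinct eigenvalues. *)
Definition transition (t : R) : 'M[R[i]]_n :=
  \sum_(mu \in lap_spectrum) (expi (t * mu) *: lap_proj mu).

Definition proper_LaFR (a b : 'I_n) (tau : R) : Prop :=
  exists alpha beta : R[i],
    basis_vec a *m transition tau = alpha *: basis_vec a + beta *: basis_vec b
    /\ beta != 0.

Definition strongly_cospectral (a b : 'I_n) : Prop :=
  forall mu, lap_spectrum mu ->
    basis_vec a *m lap_proj mu = basis_vec b *m lap_proj mu \/
    basis_vec a *m lap_proj mu = - (basis_vec b *m lap_proj mu).

Definition Phi_plus (a b : 'I_n) : set R :=
  [set mu | [/\ lap_spectrum mu,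
    basis_vec a *m lap_proj mu = basis_vec b *m lap_proj mu
    & basis_vec a *m lap_proj mu != 0]].

Definition Phi_minus (a b : 'I_n) : set R :=
  [set mu | [/\ lap_spectrum mu,
    basis_vec a *m lap_proj mu = - (basis_vec b *m lap_proj mu)
    & basis_vec a *m lap_proj mu != 0]].

Definition Phi_differences (a b : 'I_n) : set R :=
  [set d | exists mu nu : R, d = mu - nu /\
    ((Phi_plus a b mu /\ Phi_plus a b nu) \/
     (Phi_minus a b mu /\ Phi_minus a b nu))].

End Revival.

(* Divisibility by a natural number in the ring of integers, for x : R;
   it fails when x is not an integer. *)
Definition natdvd_real (R : realType) (d : nat) (x : R) : Prop :=
  exists k : int, x = (k * d%:Z)%:~R.

(* The gcd of a set S of integers, embedded in R: the natural number whose
   divisors are the common divisors of S (hence 0 when S is contained in {0}).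
   If S has a non-integral element there is no common divisor, and the value is
   the default 0. *)
Definition gcd_set (R : realType) (S : set R) : nat :=
  xget 0%N [set g : nat |
    forall d : nat, (d %| g)%N <-> (forall x, S x -> natdvd_real d x)].

Definition graph_connected (n : nat) (adj : rel 'I_n) : Prop :=
  forall i j : 'I_n, connect adj i j.

(* Main.v *)
(* Write U = U(tau) and suppose U e_a = alpha e_a + beta e_b with beta != 0.
   Since U is unitary and symmetric, U e_b lies in the span of e_a and e_b, and
   since U fixes the all-ones vector, U fixes e_a + e_b and multiplies e_a - e_b
   by z = alpha - beta != 1.  So proper revival at tau means that exp(i tau mu)
   is 1 on the eigenvalue support of e_a + e_b and a constant z != 1 on that of
   e_a - e_b; the supports are then disjoint, which is strong cospectrality.

   For integrality, no Galois theory is needed: the sum of the eigenvalues in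
   the support of a rational vector is rational, being a coefficient of its
   minimal polynomial.  The eigenvalues in the support of e_a + e_b are
   nonnegative integer multiples of c = 2 pi / tau, so if one of them is nonzero
   then c is rational, and so are all of them; in the support of e_a - e_b the
   differences are multiples of c, which again gives rationality.  If the
   support of e_a + e_b is {0}, then {a, b} is a union of components and
   e_a - e_b is an eigenvector with an integer eigenvalue.  A rational
   eigenvalue of an integer matrix is an integer.

   By Bezout, tau g is a multiple of 2 pi; conversely tau = 2 pi / g works, or,
   if g = 0, tau = pi / mu for the only mu in Phi^-. *)

Require Import Defs.
From mathcomp Require Import all_boot all_order all_algebra.
From mathcomp Require Import all_classical all_reals all_analysis.
From mathcomp Require Import complex algC algnum spectral mxpoly.
From mathcomp Require Import ring lra.
Set Implicit Arguments.
Unset Strict Implicit.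
Unset Printing Implicit Defensive.

Import Order.TTheory GRing.Theory Num.Theory.

Local Open Scope classical_set_scope.
Local Open Scope ring_scope.

(** * Phases [exp(i x)] of real numbers *)

Lemma expi0 (R : realType) : expi (0 : R) = 1.
Proof. by rewrite /expi sin0 cos0. Qed.

Lemma expiD (R : realType) (x y : R) : expi (x + y) = expi x * expi y.
Proof.
rewrite /expi sinD cosD; apply/eqP; rewrite eq_complex /= eqxx.
by rewrite addrC mulrC eqxx.
Qed.

Lemma expi_neq0 (R : realType) (x : R) : expi x != 0.
Proof.
apply/eqP => x0; have := @oner_neq0 R[i]%C.
by rewrite -(expi0 R) -(subrr x) expiD x0 mul0r eqxx.
Qed.

Lemma expi2pi (R : realType) (k : int) : expi (k%:~R * (2 * pi) : R) = 1.
Proof.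
have expi_nat m : expi (m%:R * (2 * pi) : R) = 1.
  elim: m => [|m IH]; first by rewrite mul0r expi0.
  rewrite -natr1 mulrDl expiD IH !mul1r /expi mulr_natl.
  by rewrite cos2pi sin2pi.
case: k => m; first by rewrite -pmulrn expi_nat.
rewrite NegzE mulNr.
have := expiD (- (m.+1%:R * (2 * pi) : R)) (m.+1%:R * (2 * pi)).
by rewrite addNr expi0 expi_nat mulr1 => /esym.
Qed.

(** Reduce [x] modulo [2 pi] to [y] in [[0, 2 pi)]. By the double-angle formula [cos y = 1] forces
    [sin (y / 2) = 0], and sine is positive on [(0, pi)], so [y = 0]. *)
Lemma expi_eq1 (R : realType) (x : R) :
  expi x = 1 <-> exists k : int, x = k%:~R * (2 * pi).
Proof.
split=> [x1|[k ->]]; last exact: expi2pi.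
have pi2_gt0 : 0 < 2 * pi :> R by rewrite mulr_gt0 // pi_gt0.
pose k := Num.floor (x / (2 * pi)); pose y := x - k%:~R * (2 * pi).
exists k; apply/eqP; rewrite -subr_eq0 -/y; apply/eqP.
have y_ge0 : 0 <= y.
  by rewrite subr_ge0 -ler_pdivlMr // floor_le_tmp.
have y_lt : y < 2 * pi.
  rewrite ltrBlDr -[X in X + _]mul1r -mulrDl addrC -ltr_pdivrMr //.
  by rewrite -[1]/(1%:~R) -intrD; exact: floorD1_gt.
have : expi y = 1 by rewrite /y expiD x1 mul1r -mulNr -rmorphN expi2pi.
case=> cosy _; pose z := y / 2.
have yE : y = z *+ 2 by rewrite /z; lra.
move: cosy; rewrite yE cos_mulr2n cos2sin2 => cosz.
have sinz : sin z = 0.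
  by apply/eqP; rewrite -sqrf_eq0; apply/eqP; lra.
have [z_gt0|] := ltP 0 z; last by rewrite /z; lra.
have := @sin_gt0_pi R z; rewrite sinz ltxx z_gt0 => /(_ _)/negP [] //.
by rewrite /z; lra.
Qed.

Lemma conj_expi (R : realType) (x : R) : Num.conj (expi x) = expi (- x).
Proof. by rewrite /expi cosN sinN. Qed.

(** * Integrality of eigenvalues and rationality of their sums *)

Lemma integer_rational_eigenvalue n (M : 'M[int]_n) (q : rat) :
  eigenvalue (map_mx intr M) q -> q \is a Num.int.
Proof.
rewrite eigenvalue_root_char -map_char_poly => rq.
(* In [algC], a root of the monic integral characteristic polynomial is an algebraic integer, and a
   rational algebraic integer is an integer. *)
have rqC : root (map_poly intr (char_poly M)) (ratr q : algC).
  have -> : map_poly intr (char_poly M) =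
      map_poly (@ratr algC) (map_poly intr (char_poly M)).
    by rewrite -map_poly_comp; apply: eq_map_poly => m /=; rewrite ratr_int.
  by rewrite fmorph_root.
have : (ratr q : algC) \in Aint.
  apply: root_monic_Aint rqC _ _; first by rewrite map_char_poly char_poly_monic.
  by apply/polyOverP => i; rewrite coef_map /= intr_int.
move/(Cint_rat_Aint (Crat_rat _)) => /intrP[m /eqP].
by rewrite -(ratr_int algC) (inj_eq (fmorph_inj _)) => /eqP ->; apply: intr_int.
Qed.

(* The Krylov vectors [W A^i] with [i < size s] are independent, and [W] is
   annihilated by the monic polynomial of degree [size s] with root set [s];
   its coefficients are unique, hence lie in the subfield. *)
Lemma sum_eigenvalues_subfield (F0 F : fieldType) (f : {rmorphism F0 -> F}) n
    (A : 'M[F0]_n) (w : 'rV[F0]_n) (s : seq F) (P : F -> 'M[F]_n)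
    (AP : forall z, z \in s -> map_mx f A *m P z = z *: P z)
    (PA : forall z, z \in s -> P z *m map_mx f A = z *: P z) :
  uniq s -> \sum_(z <- s) map_mx f w *m P z = map_mx f w ->
  (forall z, z \in s -> map_mx f w *m P z != 0) ->
  exists q, \sum_(z <- s) z = f q.
Proof.
move=> s_uniq wE wP_neq0; set W := map_mx f w.
have [->|s_neq0] := eqVneq s [::]; first by exists 0; rewrite big_nil rmorph0.
pose kry i := iter i (fun v => v *m A) w.
pose Kry i := map_mx f (kry i).
have KryS i : Kry i.+1 = Kry i *m map_mx f A by rewrite /Kry /= map_mxM.
have KryP i z : z \in s -> Kry i *m P z = z ^+ i *: (W *m P z).
  move=> zs; elim: i => [|i IH]; first by rewrite scale1r.
  by rewrite KryS -mulmxA AP // -scalemxAr IH scalerA exprS.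
have KryE i : Kry i = \sum_(z <- s) z ^+ i *: (W *m P z).
  elim: i => [|i IH]; first by under eq_bigr do rewrite scale1r.
  rewrite KryS IH mulmx_suml big_seq [RHS]big_seq.
  apply: eq_bigr => z zs.
  by rewrite -scalemxAl -mulmxA PA // -scalemxAr scalerA exprSr.
pose d := size s; pose M := \matrix_(i < d) kry i.
pose p := \prod_(z <- s) ('X - z%:P).
have size_p : size p = d.+1 by rewrite size_prod_XsubC.
(* Over [F], the coefficients of [p] express [Kry d] through the earlier Krylov vectors. Membership
   in a row space descends along a field extension, so coefficients [u] exist over [F0]. *)
have /submxP[u uE] : (kry d <= M)%MS.
  rewrite -(map_submx f) -/(Kry d).
  have -> : Kry d = (\row_(i < d) - p`_i) *m map_mx f M.
    have : \sum_(i < d.+1) p`_i *: Kry i = 0.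
      under eq_bigr => j _ do rewrite KryE scaler_sumr.
      rewrite exchange_big big_seq big1 //= => z zs.
      under eq_bigr => j _ do rewrite scalerA.
      rewrite -scaler_suml -size_p -horner_coef.
      by have /eqP -> : root p z; [rewrite root_prod_XsubC | rewrite scale0r].
    rewrite big_ord_recr /=.
    have -> : p`_d = 1.
      by have /monicP := monic_prod_XsubC s xpredT id; rewrite /lead_coef size_p.
    rewrite scale1r addrC => /eqP; rewrite addr_eq0 => /eqP ->.
    rewrite mulmx_sum_row -sumrN; apply: eq_bigr => i _.
    by rewrite mxE scaleNr -map_row rowK.
  exact: submxMl.
pose q := 'X^d - \poly_(i < d) (oapp (u 0%R) 0%R (insub i)).
have size_poly_lt : (size (\poly_(i < d)
    (oapp (u 0%R) 0%R (insub i))) < size ('X^d : {poly F0}))%N.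
  by rewrite size_polyXn ltnS size_poly.
have size_q : size q = d.+1 by rewrite size_polyDl ?size_polyN // size_polyXn.
have lead_q : lead_coef q = 1.
  by rewrite lead_coefDl ?size_polyN // lead_coefXn.
have q_root : all (root (map_poly f q)) s.
  apply/allP => z zs; rewrite /root.
  suff : (map_poly f q).[z] *: (W *m P z) == 0.
    by rewrite scaler_eq0 (negPf (wP_neq0 _ zs)) orbF.
  rewrite rmorphB /= map_polyXn hornerD hornerN hornerXn scalerBl -KryP //.
  have -> : Kry d = \sum_(i < d) f (u 0 i) *: Kry i.
    rewrite /Kry uE map_mxM mulmx_sum_row; apply: eq_bigr => i _.
    by rewrite -map_row rowK mxE.
  rewrite mulmx_suml subr_eq0; apply/eqP.
  rewrite (@horner_coef_wide _ d); last by rewrite size_map_poly size_poly.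
  rewrite scaler_suml; apply: eq_bigr => i _.
  by rewrite -scalemxAl KryP // scalerA coef_map coef_poly ltn_ord valK.
(* Both are monic of degree [d] with the same [d] distinct roots; the coefficient below the leading
   one is then minus the sum of the roots. *)
have pE : map_poly f q = p.
  rewrite [LHS](@all_roots_prod_XsubC _ _ s) ?uniq_rootsE ?size_map_poly //.
  by rewrite lead_coef_map lead_q rmorph1 scale1r.
exists (- q`_d.-1); rewrite rmorphN -coef_map pE coefPn_prod_XsubC ?opprK //.
by rewrite size_eq0.
Qed.

(** * The gcd of a finite set of integers *)

Lemma natdvd_realE (R : realType) (d : nat) (m : int) :
  natdvd_real d (m%:~R : R) <-> (d%:Z %| m)%Z.
Proof.
split=> [[k /intr_inj ->]|/dvdzP[k ->]]; first exact: dvdz_mull.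
by exists k.
Qed.

(** Induction with the binary Bezout identity. The second clause is Bezout as a closure principle,
    which avoids carrying a list of coefficients. *)
Lemma gcd_int_seq (l : seq int) : exists2 g : nat,
  forall d : nat, (d %| g)%N <-> forall x, x \in l -> (d%:Z %| x)%Z
  & forall P : int -> Prop, P 0 ->
      (forall u v x y, P x -> P y -> P (u * x + v * y)) ->
      (forall x, x \in l -> P x) -> P g%:Z.
Proof.
elim: l => [|m l [g gP gB]]; first by exists 0%N.
exists `|gcdz m g|%N => [d|P P0 Plin Pl].
  have -> : (d %| `|gcdz m g|)%N = (d%:Z %| gcdz m g)%Z by [].
  rewrite dvdz_gcd; split=> [/andP[dm dg] x|dvd_l].
    by rewrite inE => /predU1P[->//|]; apply/gP: x.
  rewrite dvd_l ?mem_head //=; apply/gP => x xl; apply: dvd_l.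
  by rewrite inE xl orbT.
have [u [v]] := Bezoutz m g; rewrite abszE ger0_norm // => <-.
apply: (Plin); first by apply: Pl; rewrite mem_head.
by apply: gB => // x xl; apply: Pl; rewrite inE xl orbT.
Qed.

(** Finiteness and integrality provide a number meeting the condition in [gcd_set], so [xget]
    returns such a number; mutual divisibility makes it unique. *)
Lemma gcd_setP (R : realType) (S : set R) :
  finite_set S -> (forall x, S x -> x \is a Num.int) ->
  (forall d, (d %| gcd_set S)%N <-> forall x, S x -> natdvd_real d x)
  /\ (forall P : R -> Prop, P 0 ->
        (forall (u v : int) x y, P x -> P y -> P (u%:~R * x + v%:~R * y)) ->
        (forall x, S x -> P x) -> P (gcd_set S)%:R).
Proof.
case/finite_seqP => l SE Sint.
have [g gP gB] := gcd_int_seq [seq Num.floor x | x <- l].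
have SP d : (forall x, S x -> natdvd_real d x) <->
    (forall m, m \in [seq Num.floor x | x <- l] -> (d%:Z %| m)%Z).
  split=> [dS _ /mapP[x xl ->]|dl x Sx].
    have Sx : S x by rewrite SE.
    by rewrite -(natdvd_realE R) floorK ?Sint //; apply: dS.
  rewrite -(floorK (Sint x Sx)) natdvd_realE; apply: dl.
  by apply: map_f; rewrite SE in Sx.
have gS d : (d %| g)%N <-> forall x, S x -> natdvd_real d x.
  by rewrite SP.
have gcdP d : (d %| gcd_set S)%N <-> forall x, S x -> natdvd_real d x.
  by rewrite /gcd_set; case: xgetP => [h _ hP|/(_ g)]; [exact: hP | case].
split=> // P P0 Plin PS.
have -> : gcd_set S = g.
  apply/eqP; rewrite eqn_dvd; apply/andP; split.
    by apply/gS/gcdP.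
  by apply/gcdP/gS.
apply: (gB (fun m => P m%:~R)) => [|u v x y Px Py|_ /mapP[x xl ->]].
- by [].
- by rewrite intrD !intrM; apply: Plin.
- by rewrite floorK ?Sint ?SE //; apply: PS; rewrite SE.
Qed.

(** The rows of [1 - F] are orthogonal to the row space of [F], so the adjoint of [F] equals [F]
    times its adjoint, which is self-adjoint. *)
Lemma proj_ortho_hermitian (C : numClosedFieldType) p n (U : 'M[C]_(p, n)) :
  map_mx Num.conj (proj_ortho U)^T = proj_ortho U.
Proof.
set F := proj_ortho U.
have : (1%:M - F) *m map_mx Num.conj F^T = 0.
  apply/orthomx1P; rewrite (eqmx_ortho _ (proj_orthoE U)).
  by have := proj_ortho_compl_sub U 1%:M; rewrite mul1mx.
rewrite mulmxBl mul1mx => /eqP; rewrite subr_eq0 => /eqP FE.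
clearbody F; rewrite FE; move/(congr1 (fun M => map_mx Num.conj M^T)): FE.
by rewrite trmx_mul map_mxM trmxCK => <-.
Qed.

(** * Orthogonal projections on the eigenspaces of a Hermitian matrix *)

Section SpectralDecomposition.
Variables (R : rcfType) (n : nat) (A : 'M[R[i]%C]_n).
Hypothesis A_herm : map_mx Num.conj A^T = A.

Local Notation P mu := (proj_ortho (eigenspace A (real_complex R mu))).

Lemma eigenproj_mulr mu : P mu *m A = (real_complex R mu) *: P mu.
Proof. by apply/eigenspaceP; rewrite proj_orthoE. Qed.

Lemma eigenproj_mull mu : A *m P mu = (real_complex R mu) *: P mu.
Proof.
have := congr1 (fun M => map_mx Num.conj M^T) (eigenproj_mulr mu).
rewrite trmx_mul map_mxM A_herm proj_ortho_hermitian => ->.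
rewrite linearZ /= map_mxZ proj_ortho_hermitian; congr (_ *: _).
by apply/conj_Creal/complex_realP; exists mu.
Qed.

Lemma eigenproj_idem mu : P mu *m P mu = P mu.
Proof. exact: proj_ortho_proj. Qed.

(** Evaluate [P mu *m A *m P nu] from both sides and compare the two scalars. *)
Lemma eigenproj_ortho mu nu : mu != nu -> P mu *m P nu = 0.
Proof.
move=> mu_nu.
have := mulmxA (P mu) A (P nu).
rewrite eigenproj_mulr eigenproj_mull -scalemxAl -scalemxAr => /esym/eqP.
rewrite -subr_eq0 -scalerBl scaler_eq0 => /orP[|/eqP //].
by rewrite -rmorphB /= fmorph_eq0 subr_eq0 (negPf mu_nu).
Qed.

Lemma eigenprojM mu nu : P mu *m P nu = if mu == nu then P mu else 0.
Proof. by case: eqVneq => [->|/eigenproj_ortho //]; rewrite eigenproj_idem. Qed.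

(** The rows of the unitary matrix [Q] diagonalizing [A] are eigenvectors, each fixed by exactly one
    projection of the sum and killed by the others; cancelling [Q] gives the resolution of the
    identity. *)
Lemma eigenproj_resolution : exists s : seq R, [/\ uniq s,
  forall mu, (mu \in s) = eigenvalue A (real_complex R mu)
  & \sum_(mu <- s) P mu = 1%:M].
Proof.
have A_hermsym : A \is hermsymmx.
  by apply/is_hermitianmxP; rewrite expr0 scale1r A_herm.
pose Q := spectralmx A; pose D := spectral_diag A.
have AE : Q *m A = diag_mx D *m Q.
  have /orthomx_spectralP AE := hermitian_normalmx A_hermsym.
  by rewrite [A in LHS]AE !mulmxA mulmxV ?spectral_unit // mul1mx.
pose lam j := complex.Re (D 0 j).
have lamE j : real_complex R (lam j) = D 0 j.
  by apply: RRe_real; apply/mxOverP: 0 j; exact: hermitian_spectral_diag_real.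
have QA j : row j Q *m A = real_complex R (lam j) *: row j Q.
  by rewrite -row_mul AE mul_diag_mx lamE; apply/rowP => k; rewrite !mxE.
pose s := undup [seq lam j | j : 'I_n].
have sP : \sum_(mu <- s) P mu = 1%:M.
  apply: (can_inj (mulKmx (spectral_unit A))); rewrite mulmx1.
  apply/row_matrixP => j; rewrite row_mul mulmx_sumr.
  have ls : lam j \in s by rewrite mem_undup; apply/fintype.imageP; exists j.
  rewrite (bigD1_seq (lam j)) ?undup_uniq //= big1 ?addr0.
    by apply: proj_ortho_id; apply/eigenspaceP/QA.
  move=> mu mu_neq; set x := row j Q in QA *.
  have := mulmxA x A (P mu).
  rewrite QA eigenproj_mull -scalemxAl -scalemxAr => /esym/eqP.
  rewrite -subr_eq0 -scalerBl scaler_eq0 => /orP[|/eqP //].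
  by rewrite -rmorphB /= fmorph_eq0 subr_eq0 eq_sym (negPf mu_neq).
exists s; split=> // [|mu]; first exact: undup_uniq.
apply/idP/idP => [|/eigenvalueP[v vA v_neq0]].
  rewrite mem_undup => /fintype.imageP[j _ ->]; apply/eigenvalueP; exists (row j Q) => //.
  apply/negP => /eqP rQ0.
  have := congr1 (row j) (mulmxV (spectral_unit A)).
  rewrite row_mul -/Q rQ0 mul0mx row1 => /rowP/(_ j).
  by rewrite !mxE !eqxx => /esym/eqP; rewrite oner_eq0.
(* For [mu] outside [s], inserting the resolution of the identity before [P mu] gives [v = 0] by
   orthogonality. *)
have vP : v *m P mu = v by apply: proj_ortho_id; apply/eigenspaceP.
apply: contraNT v_neq0 => mu_s.
rewrite -vP -[v]mulmx1 -mulmxA mul1mx -[P mu]mul1mx -sP mulmx_suml mulmx_sumr.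
rewrite big_seq big1 // => nu nus; rewrite eigenproj_ortho ?mulmx0 //.
by apply: contraNneq mu_s => <-.
Qed.

(** For symmetric [A] the rows of the transpose of [P mu] are eigenvectors too, so [P mu] fixes
    them; transposing that identity gives symmetry. *)
Lemma tr_eigenproj mu : A^T = A -> (P mu)^T = P mu.
Proof.
move=> A_sym; have PTP : (P mu)^T *m P mu = (P mu)^T.
  apply: proj_ortho_id; apply/eigenspaceP.
  by have := congr1 trmx (eigenproj_mull mu); rewrite trmx_mul A_sym linearZ.
by have := congr1 trmx PTP; rewrite trmx_mul trmxK PTP.
Qed.

End SpectralDecomposition.

(** * The Laplacian *)

Lemma map_laplacian (K1 K2 : nzRingType) (f : {rmorphism K1 -> K2}) n
    (adj : rel 'I_n) : map_mx f (laplacian K1 adj) = laplacian K2 adj.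
Proof.
by apply/matrixP => i j; rewrite !mxE rmorphB rmorphMn !rmorph_nat.
Qed.

Section LaplacianSpectrum.
Variables (R : realType) (n : nat) (adj : rel 'I_n).
Hypothesis adj_sym : symmetric adj.

Local Notation L := (laplacian R[i]%C adj).
Local Notation F mu := (@lap_proj R n adj mu).
Local Notation "x %:C" := (real_complex R x).

Lemma tr_laplacian (K : nzRingType) : (laplacian K adj)^T = laplacian K adj.
Proof.
apply/matrixP => i j; rewrite !mxE adj_sym; congr (_ - _).
by case: eqVneq => [->|ij]; rewrite ?eqxx // eq_sym (negPf ij).
Qed.

Lemma laplacian_hermitian : map_mx Num.conj L^T = L.
Proof. by rewrite tr_laplacian map_laplacian. Qed.

Lemma mul_laplacianE (K : nzRingType) (v : 'rV[K]_n) i :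
  (v *m laplacian K adj) 0 i = \sum_j (v 0 i - v 0 j) * (adj i j)%:R.
Proof.
rewrite mulmxBr mul_mx_diag !mxE.
under [RHS]eq_bigr do rewrite mulrBl.
rewrite sumrB; congr (_ - _); last first.
  by apply: eq_bigr => j _; rewrite mxE adj_sym.
rewrite -mulr_sumr -sum1_card natr_sum big_mkcond /=; congr (_ * _).
by apply: eq_bigr => j _; rewrite inE; case: adj.
Qed.

Lemma ones_laplacian (K : nzRingType) : const_mx 1 *m laplacian K adj = 0 :> 'rV_n.
Proof.
apply/rowP => i; rewrite mul_laplacianE [RHS]mxE big1 // => j _.
by rewrite !mxE subrr mul0r.
Qed.

Lemma lap_spectrum_ge0 (mu : R) : lap_spectrum adj mu -> 0 <= mu.
Proof.
case/eigenvalueP => v vL v_neq0.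
pose E i j : R[i]%C := (v 0 i - v 0 j) * (adj i j)%:R * Num.conj (v 0 i).
pose Q := \sum_i \sum_j E i j.
have QE : Q = mu%:C * \sum_i v 0 i * Num.conj (v 0 i).
  rewrite mulr_sumr; apply: eq_bigr => i _.
  by rewrite -mulr_suml -mul_laplacianE vL mxE mulrA.
(* Swapping [i] and [j] in one copy of [Q] pairs the terms into the squared moduli of
   [v 0 i - v 0 j] over adjacent pairs. *)
have Q_ge0 : 0 <= Q + Q.
  rewrite {2}/Q exchange_big -big_split sumr_ge0 //= => i _.
  rewrite -big_split sumr_ge0 //= => j _; rewrite /E [adj j i]adj_sym.
  have -> : (v 0 i - v 0 j) * (adj i j)%:R * Num.conj (v 0 i)
      + (v 0 j - v 0 i) * (adj i j)%:R * Num.conj (v 0 j)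
    = (adj i j)%:R * ((v 0 i - v 0 j) * Num.conj (v 0 i - v 0 j)).
    by rewrite rmorphB /=; ring.
  by rewrite mulr_ge0 ?ler0n ?mul_conjC_ge0.
have norm_gt0 : 0 < \sum_i v 0 i * Num.conj (v 0 i).
  have [i vi_neq0] : exists i, v 0 i != 0 by apply/rV0Pn.
  rewrite (bigD1 i) //= ltr_wpDr ?sumr_ge0 // => [j _|].
    exact: mul_conjC_ge0.
  by rewrite mul_conjC_gt0.
move: Q_ge0; rewrite QE -mulr2n pmulrn_lge0 // pmulr_lge0 //.
by rewrite ler0c.
Qed.

(** Being an eigenvalue descends from [R[i]] to the rationals, where the Laplacian has integer
    entries. *)
Lemma lap_spectrum_nat (mu : R) q :
  lap_spectrum adj mu -> mu = ratr q -> mu \is a Num.nat.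
Proof.
move=> mu_spec muE; rewrite natrEint lap_spectrum_ge0 // andbT.
move: mu_spec; rewrite /lap_spectrum /= {}muE (fmorph_rat (real_complex R)).
rewrite -(map_laplacian (@ratr R[i]%C)) eigenvalue_map.
rewrite -(map_laplacian (intr : int -> rat)).
move/integer_rational_eigenvalue => /intrP[m ->].
by rewrite ratr_int intr_int.
Qed.

Lemma trmx_lap_proj mu : (F mu)^T = F mu.
Proof. exact: (tr_eigenproj laplacian_hermitian _ (tr_laplacian _)). Qed.

Lemma conj_lap_proj mu : map_mx Num.conj (F mu) = F mu.
Proof. by rewrite -{1}trmx_lap_proj; apply: proj_ortho_hermitian. Qed.

Lemma lap_projM mu nu : F mu *m F nu = if mu == nu then F mu else 0.
Proof. exact: (eigenprojM laplacian_hermitian). Qed.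

Lemma lap_proj_mull mu : L *m F mu = mu%:C *: F mu.
Proof. exact: (eigenproj_mull laplacian_hermitian). Qed.

Lemma lap_proj_mulr (mu : R) : F mu *m L = mu%:C *: F mu.
Proof. exact: eigenproj_mulr. Qed.

Lemma lap_eigenvector_support (v : 'rV_n) mu nu :
  v *m L = mu%:C *: v -> v *m F nu != 0 -> nu = mu.
Proof.
move=> vL; apply: contraNeq => nu_mu.
have <- : v *m F mu = v by apply: proj_ortho_id; apply/eigenspaceP.
by rewrite -mulmxA lap_projM [mu == nu]eq_sym (negPf nu_mu) mulmx0.
Qed.

End LaplacianSpectrum.

(** * Revival in terms of eigenvalue supports *)

Section Transition.
Variables (R : realType) (n : nat) (adj : rel 'I_n).
Hypothesis adj_sym : symmetric adj.

Local Notation L := (laplacian R[i]%C adj).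
Local Notation F mu := (@lap_proj R n adj mu).
Local Notation U t := (@transition R n adj t).
Local Notation "x %:C" := (real_complex R x).

Variable s : seq R.
Hypothesis s_uniq : uniq s.
Hypothesis s_spec : lap_spectrum adj = [set` s].
Hypothesis s_sum : \sum_(mu <- s) F mu = 1%:M.

Lemma mul_lap_resolution (v : 'rV_n) : \sum_(mu <- s) v *m F mu = v.
Proof. by rewrite -mulmx_sumr s_sum mulmx1. Qed.

Lemma transitionE t : U t = \sum_(mu <- s) expi (t * mu) *: F mu.
Proof. by rewrite /transition s_spec -fsbig_seq. Qed.

Lemma transition_proj t mu : mu \in s -> U t *m F mu = expi (t * mu) *: F mu.
Proof.
move=> mus; rewrite transitionE mulmx_suml (bigD1_seq mu) //= big1.
  by rewrite addr0 -scalemxAl lap_projM // eqxx.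
by move=> nu nu_mu; rewrite -scalemxAl lap_projM // (negPf nu_mu) scaler0.
Qed.

(** With its converse [scalar_transition], this translates eigenvectors of [U t] into phases that
    are constant on an eigenvalue support. *)
Lemma transition_scalar t (v : 'rV_n) (c : R[i]%C) :
  (forall mu, mu \in s -> v *m F mu != 0 -> expi (t * mu) = c) ->
  v *m U t = c *: v.
Proof.
move=> vc; rewrite -{2}(mul_lap_resolution v) transitionE mulmx_sumr scaler_sumr.
rewrite big_seq [RHS]big_seq; apply: eq_bigr => mu mus; rewrite -scalemxAr.
have [->|vF] := eqVneq (v *m F mu) 0; first by rewrite !scaler0.
by rewrite (vc mu).
Qed.

Lemma scalar_transition t (v : 'rV_n) (c : R[i]%C) mu :
  v *m U t = c *: v -> mu \in s -> v *m F mu != 0 -> expi (t * mu) = c.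
Proof.
move=> vU mus vF; have := congr1 (mulmx^~ (F mu)) vU.
rewrite -mulmxA transition_proj // -scalemxAr -scalemxAl => /eqP.
by rewrite -subr_eq0 -scalerBl scaler_eq0 (negPf vF) orbF subr_eq0 => /eqP.
Qed.

Lemma trmx_transition t : (U t)^T = U t.
Proof.
rewrite transitionE raddf_sum; apply: eq_bigr => mu _.
by rewrite /= linearZ /= trmx_lap_proj.
Qed.

(** As [U t] is symmetric, its entrywise conjugate is its adjoint. In the spectral sum the conjugate
    phases cancel. *)
Lemma transition_unitary t : U t *m map_mx Num.conj (U t) = 1%:M.
Proof.
rewrite [in X in _ *m X]transitionE map_mx_sum mulmx_sumr -s_sum.
rewrite big_seq [RHS]big_seq; apply: eq_bigr => mu mus.
rewrite map_mxZ conj_lap_proj // -scalemxAr transition_proj // scalerA.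
by rewrite /= conj_expi -expiD addNr expi0 scale1r.
Qed.

Lemma ones_transition t : const_mx 1 *m U t = const_mx 1 :> 'rV_n.
Proof.
rewrite -[RHS]scale1r; apply: transition_scalar => mu mus oF.
suff -> : mu = 0 by rewrite mulr0 expi0.
apply: lap_eigenvector_support oF => //.
by rewrite ones_laplacian // scale0r.
Qed.

Section Revival.
Variables (a b : 'I_n).
Hypothesis a_neq_b : a != b.

Local Notation ea := (basis_vec R a).
Local Notation eb := (basis_vec R b).

Lemma revival_block t (al be : R[i]%C) :
  ea *m U t = al *: ea + be *: eb -> be != 0 ->
  al + be = 1 /\ eb *m U t = be *: ea + al *: eb.
Proof.
move=> aU be_neq0.
have Ube c : basis_vec R c *m U t *m (const_mx 1 : 'cV_n) = 1%:M.
  rewrite -mulmxA; have := congr1 trmx (ones_transition t).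
  rewrite trmx_mul trmx_transition trmx_const => ->.
  apply/rowP => i; rewrite !mxE ord1 (bigD1 c) //= big1 ?addr0.
    by rewrite !mxE !eqxx mulr1.
  by move=> j j_c; rewrite !mxE (negPf j_c) mul0r.
have Ube' c : basis_vec R c *m (const_mx 1 : 'cV_n) = 1%:M.
  apply/rowP => i; rewrite !mxE ord1 (bigD1 c) //= big1 ?addr0.
    by rewrite !mxE !eqxx mulr1.
  by move=> j j_c; rewrite !mxE (negPf j_c) mul0r.
have al_be : al + be = 1.
  have := Ube a; rewrite aU mulmxDl -!scalemxAl !Ube'.
  by move/rowP/(_ 0); rewrite !mxE eqxx !mulr1.
have [x [y bU]] : exists x y, eb *m U t = x *: ea + y *: eb.
  have conj_basis c : map_mx Num.conj (basis_vec R c) = basis_vec R c.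
    by rewrite map_delta_mx.
  have mul_conj c : basis_vec R c *m map_mx Num.conj (U t)
      = map_mx Num.conj (basis_vec R c *m U t).
    by rewrite map_mxM conj_basis.
  have := congr1 (mulmx^~ (map_mx Num.conj (U t))) aU.
  rewrite /= -mulmxA transition_unitary mulmx1 mulmxDl -!scalemxAl.
  rewrite !mul_conj aU.
  move/(congr1 (map_mx Num.conj)); rewrite conj_basis map_mxD !map_mxZ.
  rewrite -!map_mx_comp !(map_mx_id (@conjCK _)) => eaE.
  have be_conj : Num.conj be != 0 by rewrite conjC_eq0.
  (* Unitarity gives [ea = conj al *: (ea *m U t) + conj be *: (eb *m U t)]; these are the
     coefficients after solving for [eb *m U t]. *)
  exists ((1 - Num.conj al * al) / Num.conj be).
  exists (- (Num.conj al * be) / Num.conj be).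
  apply: (scalerI be_conj); rewrite scalerDr !scalerA ![Num.conj be * _]mulrC.
  rewrite !(divfK be_conj) scalerBl scale1r scaleNr -!scalerA.
  by rewrite -addrA -opprD -scalerDr {1}eaE addrC addKr.
have x_be : x = be.
  have ab : (ea *m U t) 0 b = (eb *m U t) 0 a.
    rewrite /basis_vec -!rowE [LHS]mxE [RHS]mxE.
    by have /matrixP/(_ b a) := trmx_transition t; rewrite mxE.
  move: ab; rewrite aU bU !mxE !eqxx (negPf a_neq_b) [b == a]eq_sym.
  by rewrite (negPf a_neq_b) !mulr0 !mulr1 add0r addr0 => ->.
split=> //; rewrite bU x_be; congr (_ + _ *: _).
have := Ube b; rewrite bU x_be mulmxDl -!scalemxAl !Ube'.
move/rowP/(_ 0); rewrite !mxE eqxx !mulr1 -al_be addrC => /addIr //.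
Qed.

Lemma proper_LaFRP t : proper_LaFR adj a b t <-> exists z : R[i]%C,
  [/\ z != 1,
    forall mu, mu \in s -> (ea + eb) *m F mu != 0 -> expi (t * mu) = 1
  & forall mu, mu \in s -> (ea - eb) *m F mu != 0 -> expi (t * mu) = z].
Proof.
split=> [[al [be [aU be_neq0]]]|[z [z_neq1 vp vm]]].
  have [al_be bU] := revival_block aU be_neq0.
  exists (al - be); split=> [|mu mus|mu mus].
  - rewrite -al_be -subr_eq0 opprD addrACA subrr add0r -opprD oppr_eq0.
    by rewrite -mulr2n mulrn_eq0.
  - apply: scalar_transition => //; rewrite mulmxDl aU bU addrACA -!scalerDl.
    by rewrite addrC [be + al]addrC al_be !scale1r addrC.
  - apply: scalar_transition => //; rewrite mulmxBl aU bU opprD addrACA.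
    by rewrite -!scalerBl -[be - al]opprB scaleNr scalerBr.
have two_neq0 : (2 : R[i]%C) != 0 by rewrite pnatr_eq0.
have pU := transition_scalar vp; have mU := transition_scalar vm.
(* The solution of [alpha + beta = 1] and [alpha - beta = z]; here [beta] is nonzero because [z] is
   not 1. *)
exists ((1 + z) / 2), ((1 - z) / 2); split; last first.
  by rewrite mulf_neq0 ?invr_eq0 // subr_eq0 eq_sym.
apply: (scalerI two_neq0); rewrite scalemxAl.
have -> : 2 *: ea = (ea + eb) + (ea - eb).
  by rewrite scaler_nat mulr2n addrACA subrr addr0.
rewrite mulmxDl pU mU [RHS]scalerDr !scalerA ![2 * _]mulrC !(divfK two_neq0).
by rewrite scale1r !scalerDl scalerBr !scale1r scaleNr addrACA.
Qed.

Lemma strongly_cospectralP : strongly_cospectral R adj a b <->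
  forall mu, mu \in s -> (ea + eb) *m F mu = 0 \/ (ea - eb) *m F mu = 0.
Proof.
split=> H mu mus; have := H mu.
  rewrite s_spec => /(_ mus) [] E; [right | left].
    by rewrite mulmxBl E subrr.
  by rewrite mulmxDl E addNr.
move: mus; rewrite s_spec /= => mus /(_ mus) [] /eqP; [right | left].
  by apply/eqP; rewrite -addr_eq0 -mulmxDl.
by apply/eqP; rewrite -subr_eq0 -mulmxBl.
Qed.

Hypothesis ab_sc : strongly_cospectral R adj a b.

(** On the support of [ea + eb], strong cospectrality forces the projection of [ea - eb] to vanish,
    that is, equal projections of [ea] and [eb]. *)
Lemma Phi_plusE mu :
  Phi_plus adj a b mu <-> mu \in s /\ (ea + eb) *m F mu != 0.
Proof.
rewrite /Phi_plus s_spec /=; split=> [[mus E aF]|[mus pF]].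
  by split; [exact: mus | rewrite mulmxDl -E -mulr2n -scaler_nat scaler_eq0 pnatr_eq0].
have E : ea *m F mu = eb *m F mu.
  have /strongly_cospectralP/(_ _ mus)[E|/eqP] := ab_sc; first by rewrite E eqxx in pF.
  by rewrite mulmxBl subr_eq0 => /eqP.
split; [exact: mus | exact: E |]; apply: contraNneq pF => E0.
by rewrite mulmxDl -E E0 addr0.
Qed.

Lemma Phi_minusE mu :
  Phi_minus adj a b mu <-> mu \in s /\ (ea - eb) *m F mu != 0.
Proof.
rewrite /Phi_minus s_spec /=; split=> [[mus E aF]|[mus pF]].
  rewrite mulmxBl -[eb *m _]opprK -E opprK -mulr2n.
  by rewrite -scaler_nat scaler_eq0 pnatr_eq0.
have E : ea *m F mu = - (eb *m F mu).
  have /strongly_cospectralP/(_ _ mus)[/eqP|E] := ab_sc; last by rewrite E eqxx in pF.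
  by rewrite mulmxDl addr_eq0 => /eqP.
split; [exact: mus | exact: E |]; apply: contraNneq pF => E0.
by rewrite mulmxBl -E E0 addr0.
Qed.

End Revival.
End Transition.

(** * Rationality of the eigenvalues *)

Lemma rational_int (R : realType) (m : int) : rational (m%:~R : R).
Proof. by exists m%:~R; rewrite ?ratr_int. Qed.

Lemma rationalD (R : realType) (x y : R) :
  rational x -> rational y -> rational (x + y).
Proof. by move=> [p _ <-] [q _ <-]; exists (p + q); rewrite ?rmorphD. Qed.

Lemma rationalM (R : realType) (x y : R) :
  rational x -> rational y -> rational (x * y).
Proof. by move=> [p _ <-] [q _ <-]; exists (p * q); rewrite ?rmorphM. Qed.

Lemma rationalV (R : realType) (x : R) : rational x -> rational x^-1.
Proof. by move=> [p _ <-]; exists p^-1; rewrite ?fmorphV. Qed.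

(** Nonnegativity rules out cancellation, so the sum is a nonzero integer multiple of [c]. *)
Lemma rational_common_measure (R : realType) (c : R) (l : seq R) :
  (forall x, x \in l -> 0 <= x /\ exists k : int, x = k%:~R * c) ->
  rational (\sum_(x <- l) x) -> (exists2 x, x \in l & x != 0) -> rational c.
Proof.
move=> lP lQ [x xl x_neq0].
have [k kE] : exists k : int, \sum_(x <- l) x = k%:~R * c.
  rewrite big_seq; elim/big_ind: _ => [|y z [k ->] [m ->]|y /lP[_ //]].
    by exists 0; rewrite mul0r.
  by exists (k + m); rewrite intrD mulrDl.
have kc_gt0 : 0 < k%:~R * c.
  rewrite -kE (big_rem x xl) /= ltr_wpDr //.
    by rewrite big_seq sumr_ge0 // => y /mem_rem/lP[].
  by rewrite lt_neqAle eq_sym x_neq0; have [] := lP x xl.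
have k_neq0 : k%:~R != 0 :> R by apply: contraTneq kc_gt0 => ->; rewrite mul0r ltxx.
rewrite -(mulKf k_neq0 c) -kE; apply: rationalM => //.
exact/rationalV/rational_int.
Qed.

(** The sum of all [x - y] plus the sum of all [y] is [size l] times [x]. *)
Lemma rational_of_differences (R : realType) (c : R) (l : seq R) :
  rational c ->
  (forall x y, x \in l -> y \in l -> exists k : int, x - y = k%:~R * c) ->
  rational (\sum_(x <- l) x) -> forall x, x \in l -> rational x.
Proof.
move=> cQ lP lQ x xl.
have l_neq0 : (size l)%:R != 0 :> R by rewrite pnatr_eq0 size_eq0; case: l xl {lP lQ}.
rewrite -(mulKf l_neq0 x); apply: rationalM.
  exact/rationalV/(rational_int _ (Posz _)).
have -> : (size l)%:R * x = \sum_(y <- l) (x - y) + \sum_(y <- l) y.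
  by rewrite sumrB subrK big_const_seq count_predT iter_addr_0 mulr_natl.
apply: rationalD => //; rewrite big_seq; elim/big_ind: _ => [|y z|y yl].
- exact: (rational_int _ 0).
- exact: rationalD.
by have [k ->] := lP x y xl yl; apply: rationalM => //; apply: rational_int.
Qed.

(** * The eigenvalue supports of [ea + eb] and [ea - eb] *)

Section Assembly.
Variables (R : realType) (n : nat) (adj : rel 'I_n).
Hypothesis adj_sym : symmetric adj.

Local Notation L := (laplacian R[i]%C adj).
Local Notation F mu := (@lap_proj R n adj mu).
Local Notation "x %:C" := (real_complex R x).

Variable s : seq R.
Hypothesis s_uniq : uniq s.
Hypothesis s_spec : lap_spectrum adj = [set` s].
Hypothesis s_sum : \sum_(mu <- s) F mu = 1%:M.

(** A list rather than a set, so that its elements can be summed. *)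
Definition lap_support (v : 'rV[R[i]%C]_n) : seq R :=
  [seq mu <- s | v *m F mu != 0].

Lemma mem_lap_support v mu :
  (mu \in lap_support v) = (mu \in s) && (v *m F mu != 0).
Proof. by rewrite mem_filter andbC. Qed.

Lemma sum_lap_support_rational (w : 'rV[rat]_n) :
  rational (\sum_(mu <- lap_support (map_mx ratr w)) mu).
Proof.
set v := map_mx ratr w; set l := lap_support v.
have Cinj : injective (real_complex R) by exact: complexI.
have [q qE] : exists q, \sum_(z <- [seq mu%:C | mu <- l]) z = ratr q :> R[i]%C.
  apply: (sum_eigenvalues_subfield (A := laplacian rat adj) (w := w)
    (P := fun z => proj_ortho (eigenspace L z))).
  - by move=> _ /mapP[mu _ ->]; rewrite map_laplacian; apply: lap_proj_mull.
  - by move=> _ /mapP[mu _ ->]; rewrite map_laplacian; apply: lap_proj_mulr.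
  - by rewrite map_inj_uniq // filter_uniq.
  - rewrite big_map big_filter big_mkcond -[RHS](mul_lap_resolution s_sum) /=.
    by apply: eq_bigr => mu _; case: eqP => //= ->.
  - by move=> _ /mapP[mu + ->]; rewrite mem_lap_support => /andP[].
exists q => //; apply: Cinj; rewrite (fmorph_rat (real_complex R)) -qE big_map.
by rewrite raddf_sum.
Qed.

Lemma eigenvector_of_lap_support v mu :
  (forall nu, nu \in lap_support v -> nu = mu) -> v *m L = mu%:C *: v.
Proof.
move=> vmu; rewrite -(mul_lap_resolution s_sum v) mulmx_suml scaler_sumr.
rewrite big_seq [RHS]big_seq; apply: eq_bigr => nu nus.
rewrite -mulmxA lap_proj_mulr -scalemxAr.
have [->|vF] := eqVneq (v *m F nu) 0; first by rewrite !scaler0.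
by rewrite (vmu nu) // mem_lap_support nus.
Qed.

Variables (a b : 'I_n).
Hypothesis a_neq_b : a != b.

Local Notation ea := (basis_vec R a).
Local Notation eb := (basis_vec R b).

Lemma lap_support_minus_neq0 : exists mu, mu \in lap_support (ea - eb).
Proof.
case E: (lap_support (ea - eb)) => [|mu l]; last by exists mu; rewrite mem_head.
have : ea - eb = 0.
  rewrite -(mul_lap_resolution s_sum (ea - eb)) big_seq big1 // => mu mus.
  have : mu \notin lap_support (ea - eb) by rewrite E.
  by rewrite mem_lap_support mus negbK => /eqP.
move/rowP/(_ a); rewrite !mxE !eqxx (negPf a_neq_b) subr0 => /eqP.
by rewrite oner_eq0.
Qed.

(** The all-ones vector is in the kernel and has inner product 2 with [ea + eb]. Thanks to this 0,
    the elements of [Phi_plus] are themselves among the differences whose gcd is taken. *)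
Lemma lap_support_plus0 : 0 \in lap_support (ea + eb).
Proof.
have onesF : (const_mx 1 : 'rV_n) *m F 0 = const_mx 1.
  apply: proj_ortho_id; apply/eigenspaceP.
  by rewrite ones_laplacian // scale0r.
have vF0 : (ea + eb) *m F 0 != 0.
  apply/eqP => vF; have := congr1 (mulmx (ea + eb)) (congr1 trmx onesF).
  rewrite trmx_mul trmx_lap_proj // mulmxA vF mul0mx mulmxDl trmx_const.
  rewrite /basis_vec -!rowE => /rowP/(_ 0) /esym /eqP.
  by rewrite !mxE -[1 + 1]/(2%:R) pnatr_eq0.
rewrite mem_lap_support vF0 andbT.
have : lap_spectrum adj (0 : R); last by rewrite s_spec.
apply/eigenvalueP; exists ((ea + eb) *m F 0) => //.
by rewrite -mulmxA lap_proj_mulr -scalemxAr.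
Qed.

Lemma laplacian_offdiag (K : nzRingType) i j :
  i != j -> laplacian K adj i j = - (adj i j)%:R.
Proof. by move=> ij; rewrite !mxE (negPf ij) sub0r. Qed.

(** Entry [k] of the product is minus the number of edges from [k] to [a] and [b]. *)
Lemma plus_kernel_isolated k :
  (ea + eb) *m L = 0 -> k != a -> k != b -> ~~ adj a k && ~~ adj b k.
Proof.
move=> /rowP/(_ k) + ka kb; rewrite mulmxDl /basis_vec -!rowE [LHS]mxE.
rewrite [in RHS]mxE ![row _ _ _ _]mxE !laplacian_offdiag 1?eq_sym //.
rewrite -opprD => /eqP; rewrite oppr_eq0 -natrD pnatr_eq0.
by case: adj; case: adj.
Qed.

(** Here [a] and [b] form a single edge, with eigenvalue 2, or are two isolated vertices, with
    eigenvalue 0. *)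
Lemma minus_eigenvector_of_plus_kernel :
  (ea + eb) *m L = 0 -> (ea - eb) *m L = (2 * (adj a b)%:R)%:C *: (ea - eb).
Proof.
move=> pL; apply/rowP => k.
have Lk : L a k + L b k = 0.
  have /rowP/(_ k) := pL; rewrite mulmxDl /basis_vec -!rowE [LHS]mxE.
  by rewrite ![row _ _ _ _]mxE => ->; rewrite mxE.
rewrite mulmxBl /basis_vec -!rowE [LHS]mxE [X in _ + X]mxE.
rewrite ![row _ _ _ _]mxE rmorphM !rmorph_nat.
rewrite [RHS]mxE [X in _ * X]mxE [X in _ * (_ + X)]mxE.
rewrite ![delta_mx _ _ _ _]mxE eqxx /=.
have [ka|ka] := eqVneq k a.
  have b_neq_a : b != a by rewrite eq_sym.
  rewrite ka (negPf a_neq_b) (laplacian_offdiag _ b_neq_a) in Lk *.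
  move/eqP: Lk; rewrite subr_eq0 adj_sym => /eqP ->.
  by rewrite -[true%:R]/(1 : R[i]%C) -[false%:R]/(0 : R[i]%C); ring.
have [kb|kb] := eqVneq k b.
  rewrite kb (laplacian_offdiag _ a_neq_b) in Lk *.
  move/eqP: Lk; rewrite addr_eq0 => /eqP E.
  by rewrite -E -[true%:R]/(1 : R[i]%C) -[false%:R]/(0 : R[i]%C); ring.
have /andP[/negPf ak /negPf bk] := plus_kernel_isolated pL ka kb.
by rewrite !laplacian_offdiag 1?eq_sym // ak bk; ring.
Qed.

Lemma plus_kernel_card : graph_connected adj -> (ea + eb) *m L = 0 -> (n <= 2)%N.
Proof.
move=> conn pL; pose B := [set a; b]%SET.
have B_closed : fingraph.closed adj B.
  apply: intro_closed; first exact: sym_connect_sym.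
  move=> x y xy; rewrite !inE => xB; apply/negPn/negP; rewrite negb_or => /andP[ya yb].
  have := plus_kernel_isolated pL ya yb.
  by case/orP: xB xy => /eqP -> ->; rewrite ?andbF.
have BT : [set: 'I_n]%SET \subset B.
  apply/fintype.subsetP => k _; rewrite -(closed_connect B_closed (conn a k)).
  by rewrite !inE eqxx.
by have := subset_leq_card BT; rewrite cardsT card_ord cards2 a_neq_b.
Qed.

Lemma support_nat tau (z : R[i]%C) : z != 1 ->
  (forall mu, mu \in lap_support (ea + eb) -> expi (tau * mu) = 1) ->
  (forall mu, mu \in lap_support (ea - eb) -> expi (tau * mu) = z) ->
  forall mu, (mu \in lap_support (ea + eb)) || (mu \in lap_support (ea - eb)) ->
  mu \is a Num.nat.
Proof.
move=> z_neq1 tauP tauM mu mu_supp.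
have spec nu v : nu \in lap_support v -> lap_spectrum adj nu.
  by rewrite s_spec mem_lap_support => /andP[].
suff [q _ muE] : rational mu.
  by apply: (lap_spectrum_nat adj_sym _ (esym muE)); case/orP: mu_supp; apply: spec.
(* At time 0 all phases are 1, against [z != 1] on a nonempty support. *)
have tau_neq0 : tau != 0.
  have [nu nuM] := lap_support_minus_neq0; apply: contraNneq z_neq1 => tau0.
  by rewrite -(tauM nu) // tau0 mul0r expi0.
pose c := 2 * pi / tau.
have cE (x : R) (k : int) : tau * x = k%:~R * (2 * pi) -> x = k%:~R * c.
  by move=> xk; rewrite /c mulrA -xk [tau * x]mulrC mulfK.
have basisE (k : 'I_n) : basis_vec R k = map_mx ratr (delta_mx 0 k : 'rV[rat]_n).
  by rewrite map_delta_mx.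
have sumP : rational (\sum_(nu <- lap_support (ea + eb)) nu).
  by rewrite !basisE -map_mxD; apply: sum_lap_support_rational.
have sumM : rational (\sum_(nu <- lap_support (ea - eb)) nu).
  by rewrite !basisE -map_mxB; apply: sum_lap_support_rational.
have [nz|/hasPn allz] := boolP (has (fun nu => nu != 0) (lap_support (ea + eb))).
  have plusE nu : nu \in lap_support (ea + eb) -> exists k : int, nu = k%:~R * c.
    by move=> /tauP/expi_eq1[k /cE ->]; exists k.
  have cQ : rational c.
    apply: (rational_common_measure _ sumP); last exact/hasP.
    by move=> nu nuP; split; [apply: lap_spectrum_ge0 (spec _ _ nuP) | exact: plusE].
  case/orP: mu_supp => [/plusE[k ->]|muM].
    by apply: rationalM => //; apply: rational_int.
  apply: (rational_of_differences cQ _ sumM muM) => x y xM yM.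
  have /expi_eq1[k /cE ->] : expi (tau * (x - y)) = 1; last by exists k.
  apply: (mulIf (expi_neq0 (tau * y))).
  by rewrite -expiD mulrBr subrK mul1r (tauM x) ?(tauM y).
(* The support of [ea + eb] is now just 0, which says nothing about [c]; the other support is read
   off from an explicit eigenvector. *)
have pL : (ea + eb) *m L = 0.
  rewrite -[RHS](scale0r (ea + eb)); apply: eigenvector_of_lap_support => nu.
  by move/allz; rewrite negbK => /eqP.
case/orP: mu_supp => [/allz|].
  by rewrite negbK => /eqP ->; apply: (rational_int _ 0).
rewrite mem_lap_support => /andP[_ muM].
rewrite (lap_eigenvector_support adj_sym (minus_eigenvector_of_plus_kernel pL) muM).
by exists (2 * (adj a b)%:R); rewrite ?rmorphM ?rmorph_nat.
Qed.

End Assembly.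

(** * The gcd of the differences *)

Section GcdCriterion.
Variables (R : realType) (n : nat) (adj : rel 'I_n) (a b : 'I_n).

Local Notation D := (Phi_differences (R := R) adj a b).
Local Notation g := (gcd_set D).

Lemma finite_Phi_differences (s : seq R) :
  lap_spectrum adj = [set` s] -> finite_set D.
Proof.
move=> s_spec.
have Phi_s mu : Phi_plus adj a b mu \/ Phi_minus adj a b mu -> mu \in s.
  by case=> -[+ _ _]; rewrite s_spec.
apply: (@sub_finite_set _ _ [set` [seq mu - nu | mu <- s, nu <- s]]).
  move=> _ [mu [nu [-> H]]].
  suff [mus nus] : mu \in s /\ nu \in s by apply/allpairsP; exists (mu, nu).
  by case: H => -[Hmu Hnu]; split; apply: Phi_s; [left | left | right | right].
exact: finite_seq.
Qed.

Hypothesis Phi_nat : forall mu,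
  Phi_plus adj a b mu \/ Phi_minus adj a b mu -> mu \is a @Num.nat R.

Lemma Phi_differences_int x : D x -> x \is a Num.int.
Proof.
case=> mu [nu [-> H]]; apply: rpredB; apply: intr_nat; apply: Phi_nat.
- by case: H => -[? _]; [left | right].
- by case: H => -[_ ?]; [left | right].
Qed.

End GcdCriterion.

(** The time [2 pi / g] requires a nonzero [g]. A single edge with an isolated vertex has [g = 0]
    for the ends of the edge; in a connected graph on at least three vertices, revival excludes
    this. *)
Theorem theorem7p6 (R : realType) (n : nat) (n_ge3 : (3 <= n)%N)
    (adj : rel 'I_n) (adj_sym : symmetric adj) (adj_irr : irreflexive adj)
    (a b : 'I_n) (a_neq_b : a != b) :
  let g := gcd_set (Phi_differences (R := R) adj a b) in
  ((exists tau : R, proper_LaFR adj a b tau) <->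
     [/\ strongly_cospectral R adj a b,
         Phi_plus (R := R) adj a b `|` Phi_minus adj a b
           `<=` [set mu | mu \is a Num.nat]
       & exists mu : R, Phi_minus adj a b mu /\ ~ natdvd_real g mu])
  /\ (forall tau : R, proper_LaFR adj a b tau ->
        (graph_connected adj -> g != 0%N) /\
        (g != 0%N -> exists k : int, tau = k%:~R * (2 * pi / g%:R))).
Proof.
move=> g.
have [s [s_uniq s_mem s_sum]] := eigenproj_resolution (laplacian_hermitian R adj_sym).
have s_spec : lap_spectrum (R := R) adj = [set` s].
  by apply/seteqP; split=> mu /=; rewrite s_mem.
set D := Phi_differences (R := R) adj a b in g *.
have D_fin : finite_set D := finite_Phi_differences a b s_spec.
set ea := basis_vec R a; set eb := basis_vec R b.
pose plus := lap_support adj s (ea + eb); pose minus := lap_support adj s (ea - eb).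
have plusE : strongly_cospectral R adj a b ->
    forall mu, Phi_plus adj a b mu <-> mu \in plus.
  move=> sc mu; rewrite (Phi_plusE s_spec sc) mem_lap_support.
  by split=> [[-> ->]|/andP].
have minusE : strongly_cospectral R adj a b ->
    forall mu, Phi_minus adj a b mu <-> mu \in minus.
  move=> sc mu; rewrite (Phi_minusE s_spec sc) mem_lap_support.
  by split=> [[-> ->]|/andP].
have plus0 : 0 \in plus by exact: lap_support_plus0.
have D_plus0 (sc : strongly_cospectral R adj a b) mu : mu \in plus -> D mu.
  move=> mu_plus; exists mu, 0; split; first by rewrite subr0.
  by left; split; apply/(plusE sc).
have D_minus (sc : strongly_cospectral R adj a b) mu nu :
    mu \in minus -> nu \in minus -> D (mu - nu).
  by move=> mu_m nu_m; exists mu, nu; split=> //; right; split; apply/(minusE sc).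
have D_int : Phi_plus (R := R) adj a b `|` Phi_minus adj a b
    `<=` [set mu | mu \is a Num.nat] -> forall x, D x -> x \is a Num.int.
  by move=> nat_Phi; apply: Phi_differences_int => mu /nat_Phi.
(* The relation between [tau] and [g] is kept in product form, valid also for [g = 0]. *)
have forward (tau : R) : proper_LaFR adj a b tau ->
    [/\ strongly_cospectral R adj a b,
      Phi_plus (R := R) adj a b `|` Phi_minus adj a b
        `<=` [set mu | mu \is a Num.nat],
      exists k : int, tau * g%:R = k%:~R * (2 * pi)
    & exists mu : R, Phi_minus adj a b mu /\ ~ natdvd_real g mu].
  case/(proj1 (proper_LaFRP adj_sym s_uniq s_spec s_sum a_neq_b tau)) => z [z_neq1 zP zM].
  have tauP mu : mu \in plus -> expi (tau * mu) = 1.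
    by rewrite mem_lap_support => /andP[mus]; apply: zP.
  have tauM mu : mu \in minus -> expi (tau * mu) = z.
    by rewrite mem_lap_support => /andP[mus]; apply: zM.
  have sc : strongly_cospectral R adj a b.
    apply/(strongly_cospectralP s_spec a b) => mu mus.
    have [->|pF] := eqVneq ((ea + eb) *m lap_proj adj mu) 0; first by left.
    have [->|mF] := eqVneq ((ea - eb) *m lap_proj adj mu) 0; first by right.
    (* A common eigenvalue of both supports would have phase 1 and phase [z]. *)
    by case/eqP: z_neq1; exact: etrans (esym (zM mu mus mF)) (zP mu mus pF).
  have nat_Phi : Phi_plus (R := R) adj a b `|` Phi_minus adj a b
      `<=` [set mu | mu \is a Num.nat].
    move=> mu H.
    apply: (support_nat adj_sym s_uniq s_spec s_sum a_neq_b z_neq1 tauP tauM).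
    apply/orP; case: H => [/(plusE sc mu) mu_plus|/(minusE sc mu) mu_minus].
    - by left.
    - by right.
  have [_ gB] := gcd_setP D_fin (D_int nat_Phi).
  have [k kE] : exists k : int, tau * g%:R = k%:~R * (2 * pi).
    apply: (gB (fun x => exists k : int, tau * x = k%:~R * (2 * pi))).
    - by exists 0; rewrite mulr0 mul0r.
    - move=> u v x y [k kE] [m mE]; exists (u * k + v * m).
      by rewrite mulrDr !(mulrCA tau) kE mE intrD !intrM; ring.
    move=> _ [mu [nu [-> H]]]; apply/expi_eq1.
    apply: (mulIf (expi_neq0 (tau * nu))); rewrite -expiD mulrBr subrK mul1r.
    by case: H => -[]; [move=> /(plusE sc) ? /(plusE sc) ?; rewrite !tauP
                       |move=> /(minusE sc) ? /(minusE sc) ?; rewrite !tauM].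
  split=> //; first by exists k.
  have [mu mu_minus] := lap_support_minus_neq0 (adj := adj) s_sum a_neq_b.
  exists mu; split; first exact/(minusE sc).
  (* If [g] divided [mu], then [tau * mu] would be a multiple of [2 pi], making its phase [z] equal
     to 1. *)
  case=> m muE; case/eqP: z_neq1; rewrite -(tauM mu) //; apply/expi_eq1.
  by exists (m * k); rewrite muE intrM mulrCA kE intrM mulrA.
split; last first.
  move=> tau /forward[sc nat_Phi [k kE] _]; split=> [conn|g_neq0]; last first.
    by exists k; rewrite mulrA -kE mulfK // pnatr_eq0.
  (* With [g = 0] all differences vanish, so 0 is the only element of [plus] and [ea + eb] is in the
     kernel. *)
  apply: contraL n_ge3 => /eqP g0; rewrite -ltnNge ltnS.
  apply: (plus_kernel_card (R := R) adj_sym a_neq_b conn).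
  rewrite -[RHS](scale0r (ea + eb)); apply: (eigenvector_of_lap_support s_sum).
  move=> nu nu_plus; have [gP _] := gcd_setP D_fin (D_int nat_Phi).
  have := (gP 0%N).1; rewrite -/g g0 => /(_ isT nu (D_plus0 sc nu nu_plus)).
  by case=> m ->; rewrite mulr0.
split=> [[tau /forward[? ? _ ?]] //|[sc nat_Phi [mu0 [mu0_Phi mu0_ndvd]]]].
have mu0_minus : mu0 \in minus by apply/(minusE sc).
have [gP _] := gcd_setP D_fin (D_int nat_Phi).
have gD x : D x -> natdvd_real g x by apply: (gP _).1.
suff [tau [z [z_neq1 tauP tauM]]] : exists tau (z : R[i]%C), [/\ z != 1,
    forall mu, mu \in plus -> expi (tau * mu) = 1
  & forall mu, mu \in minus -> expi (tau * mu) = z].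
  exists tau; apply/(proper_LaFRP adj_sym s_uniq s_spec s_sum a_neq_b tau).
  by exists z; split=> // mu mus muF; [apply: tauP | apply: tauM];
    rewrite mem_lap_support mus.
have [g0|g_neq0] := eqVneq g 0%N.
  have D0 x : D x -> x = 0 by move=> /gD; rewrite g0 => -[k ->]; rewrite mulr0.
  have mu0_neq0 : mu0 != 0.
    by apply/eqP => mu00; apply: mu0_ndvd; rewrite mu00; exists 0; rewrite mul0r.
  (* Here [plus] contains only 0 and [minus] only [mu0], so this time gives [z = -1]. *)
  exists (pi / mu0), (expi pi); split.
  - rewrite /expi cospi sinpi eq_complex /= negb_and; apply/orP; left.
    by apply/eqP; lra.
  - by move=> mu /(D_plus0 sc)/D0 ->; rewrite mulr0 expi0.
  move=> mu /(D_minus sc) /(_ mu0_minus) /D0 /eqP; rewrite subr_eq0 => /eqP ->.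
  by rewrite divfK.
have g_neq0' : g%:R != 0 :> R by rewrite pnatr_eq0.
have tau_dvd (x : R) : natdvd_real g x -> expi (2 * pi / g%:R * x) = 1.
  case=> k ->; apply/expi_eq1; exists k.
  by rewrite intrM -[(Posz g)%:~R]/(g%:R) mulrCA divfK.
(* All of [minus] is congruent to [mu0] modulo [g], so it shares one phase; that phase is not 1
   because [g] does not divide [mu0]. *)
exists (2 * pi / g%:R), (expi (2 * pi / g%:R * mu0)); split.
- apply/eqP => /expi_eq1[k kE]; apply: mu0_ndvd; exists k.
  have pi2_neq0 : 2 * pi != 0 :> R.
    by rewrite mulf_neq0 ?pnatr_eq0 // (gt_eqF (pi_gt0 R)).
  apply: (mulfI pi2_neq0); rewrite intrM -[(Posz g)%:~R]/(g%:R).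
  transitivity (2 * pi / g%:R * mu0 * g%:R); first by rewrite [RHS]mulrAC divfK.
  by rewrite kE; ring.
- by move=> mu /(D_plus0 sc)/gD/tau_dvd.
move=> mu /(D_minus sc) /(_ mu0_minus) /gD/tau_dvd E.
by rewrite -[mu](subrK mu0) mulrDr expiD E mul1r.
Qed.
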